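(* There exist constants $c>0$ and $n_0$ such that for every $n\ge n_0$ there exists a graph $G$ on $n$ vertices with at least $c\,n\frac{\log n}{\log\log n}$ edges whose separation dimension is at most $6$.
   Context: For points $x,y\in\mathbb{R}^d$, let $b(x,y)$ denote the closed axis-parallel box spanned by $x$ and $y$. The separation dimension of a graph $G$ is the smallest $d$ for which there is a map $\phi:V(G)\to\mathbb{R}^d$ such that whenever $\{x,y\}$ and $\{x',y'\}$ are disjoint edges of $G$, the boxes $b(\phi(x),\phi(y))$ and $b(\phi(x'),\phi(y'))$ are disjoint. *)

(* Defs.v *)
From HB Require Import structures.
From mathcomp Require Import all_boot all_order all_algebra.
From mathcomp Require Import all_classical all_reals all_analysis.

Set Implicit Arguments.
Unset Strict Implicit.
Unset Printing Implicit Defensive.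

Import Order.TTheory GRing.Theory Num.Theory.

Local Open Scope classical_set_scope.
Local Open Scope ring_scope.

Record sgraph (V : finType) := SGraph {
  adj :> rel V;
  adj_sym : symmetric adj;
  adj_irr : irreflexive adj
}.

(* Edges are unordered pairs, so #|edges G| counts each edge once. *)
Definition edges (V : finType) (G : sgraph V) : {set {set V}} :=
  [set [set p.1; p.2] | p : V * V & G p.1 p.2]%SET.

Definition box (R : realType) (d : nat) (x y : 'rV[R]_d) : set 'rV[R]_d :=
  [set z : 'rV[R]_d | forall i : 'I_d,
     Num.min (x ord0 i) (y ord0 i) <= z ord0 i <= Num.max (x ord0 i) (y ord0 i)].

Definition separating (R : realType) (V : finType) (G : sgraph V) (d : nat)
    (phi : V -> 'rV[R]_d) : Prop :=
  forall x y x' y' : V, G x y -> G x' y' ->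
    ([set x; y] :&: [set x'; y'] = finset.set0)%SET ->
    box (phi x) (phi y) `&` box (phi x') (phi y') = set0.

(* The minimum in the definition of the separation dimension is expressed
   relationally: d is the separation dimension of G. *)
Definition is_separation_dim (R : realType) (V : finType) (G : sgraph V)
    (d : nat) : Prop :=
  (exists phi : V -> 'rV[R]_d, separating G phi) /\
  (forall d' : nat,
     (exists phi : V -> 'rV[R]_d', separating G phi) -> (d <= d')%N).
Arguments is_separation_dim R {V} G d.

(* Main.v *)
(* Consider n points and n rectangles in the plane whose incidence graph is
   K_{2,2}-free. Send a point (x, y) to (x, x, y, y) and a rectangle
   [l, r] x [b, t] to (l, r, b, t). If (p, B) and (p', B') are disjoint
   incidences then p is not in B' or p' is not in B; say p lies strictly to the
   left of B'. Then l <= x < l' <= x', so the first coordinate separates the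
   two edges, and the other cases use the other coordinates. Hence the
   separation dimension is at most 4.
   For many incidences, take as points [t] x [k]^k, a point having as abscissa
   its digits read in one order and as ordinate the digits of [k]^k read in the
   other. The points on an axis-parallel line of [k]^k are those sharing a given
   prefix and a given suffix, so they are exactly the points of some rectangle.
   This gives t k^k points, t k^k rectangles and t k^(k+1) incidences, and two
   lines meet in at most one point. Finally choose k maximal with
   2 k^k <= n, and t to fill up the n vertices. *)
Require Import Defs.
From HB Require Import structures.
From mathcomp Require Import all_boot all_order all_algebra.
From mathcomp Require Import all_classical all_reals all_analysis.
From mathcomp Require Import zify lra.

Set Implicit Arguments.
Unset Strict Implicit.
Unset Printing Implicit Defensive.

Import Order.TTheory GRing.Theory Num.Theory.

Local Open Scope ring_scope.

(** * Disjointness of boxes via one coordinate *)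

Section Boxes.
Variables (R : realType) (d : nat).
Implicit Types x y : 'rV[R]_d.

Lemma boxC x y : box x y = box y x.
Proof.
by apply/seteqP; split => z /= zxy i; rewrite minC maxC; exact: zxy.
Qed.

Lemma box_disjoint x y x' y' (i : 'I_d) :
  Num.max (x ord0 i) (y ord0 i) < Num.min (x' ord0 i) (y' ord0 i) ->
  (box x y `&` box x' y')%classic = classical_sets.set0.
Proof.
move=> lt_xy; apply/seteqP; split => // z /= [/(_ i)/andP[_ zle] /(_ i)/andP[lez _]].
by have := lt_le_trans (le_lt_trans zle lt_xy) lez; rewrite ltxx.
Qed.

Lemma box_separated x y x' y' :
  (exists i : 'I_d,
     Num.max (x ord0 i) (y ord0 i) < Num.min (x' ord0 i) (y' ord0 i) \/
     Num.max (x' ord0 i) (y' ord0 i) < Num.min (x ord0 i) (y ord0 i)) ->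
  (box x y `&` box x' y')%classic = classical_sets.set0.
Proof.
by move=> [i [/box_disjoint//|/box_disjoint]]; rewrite classical_sets.setIC.
Qed.

End Boxes.

(** Well-ordering: an explicit separating map bounds the least admissible dimension. *)
Lemma separation_dim_exists (R : realType) (V : finType) (G : sgraph V) d
    (phi : V -> 'rV[R]_d) :
  separating G phi -> exists2 d', is_separation_dim R G d' & (d' <= d)%N.
Proof.
move=> sep; pose P d' := `[< exists phi : V -> 'rV[R]_d', separating G phi >].
have exP : exists d', P d' by exists d; apply/asboolP; exists phi.
case: (ex_minnP exP) => m /asboolP Pm minm; exists m.
  by split=> // d' Pd'; apply: minm; apply/asboolP.
by apply: minm; apply/asboolP; exists phi.
Qed.

(** * Padding a graph with isolated vertices *)

Section Extend.
Variables (V W : finType) (e : W -> V) (H : sgraph W).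
Hypothesis e_inj : injective e.

Definition extend_rel : rel V :=
  [rel x y | [exists u, exists v, [&& x == e u, y == e v & H u v]]].

Lemma extend_relP x y :
  reflect (exists u v, [/\ x = e u, y = e v & H u v]) (extend_rel x y).
Proof.
apply: (iffP existsP) => [[u /existsP[v /and3P[/eqP-> /eqP-> Huv]]]|].
  by exists u, v.
by move=> [u [v [-> -> Huv]]]; exists u; apply/existsP; exists v; rewrite !eqxx.
Qed.

Lemma extend_sym : symmetric extend_rel.
Proof.
by move=> x y; apply/idP/idP => /extend_relP [u [v [-> -> Huv]]];
  apply/extend_relP; exists v, u; rewrite adj_sym.
Qed.

Lemma extend_irr : irreflexive extend_rel.
Proof.
move=> x; apply/negbTE/negP => /extend_relP[u [v [-> /e_inj->]]].
by rewrite adj_irr.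
Qed.

Definition extend : sgraph V := SGraph extend_sym extend_irr.

Lemma card_edges_extend : (#|edges H| <= #|edges extend|)%N.
Proof.
rewrite -(card_imset _ (imset_inj e_inj)).
apply/subset_leq_card/fintype.subsetP => _ /imsetP[_ /imsetP[[u v] Huv ->] ->] /=.
apply/imsetP; exists (e u, e v); last by rewrite imsetU1 imset_set1.
by rewrite inE /=; apply/extend_relP; exists u, v; split => //; rewrite inE in Huv.
Qed.

Lemma separating_extend (R : realType) d (phi : W -> 'rV[R]_d) :
  separating H phi -> exists psi : V -> 'rV[R]_d, separating extend psi.
Proof.
move=> sep.
exists (fun x => if [pick u | e u == x] is Some u then phi u else 0).
have psiE u : (if [pick v | e v == e u] is Some v then phi v else 0) = phi u.
  by case: pickP => [v /eqP/e_inj->//|/(_ u)]; rewrite eqxx.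
move=> _ _ _ _ /extend_relP[u [v [-> -> Huv]]] /extend_relP[u' [v' [-> -> Huv']]].
rewrite !psiE => disj; apply: sep => //; apply/setP => w; rewrite [RHS]inE.
apply/negP => w_in; have : e w \in finset.set0; last by rewrite inE.
by rewrite -disj; move: w_in; rewrite !inE !(inj_eq e_inj).
Qed.

End Extend.

(** * Point-rectangle incidences and their embedding in dimension 4 *)

Record rect_config := RectConfig {
  pt : finType;
  rect : finType;
  px : pt -> nat;
  py : pt -> nat;
  left : rect -> nat;
  right : rect -> nat;
  bottom : rect -> nat;
  top : rect -> nat
}.

Definition inc (C : rect_config) (p : pt C) (r : rect C) : bool :=
  (left r <= px p <= right r)%N && (bottom r <= py p <= top r)%N.

Definition K22_free (C : rect_config) : Prop :=
  forall (p p' : pt C) (r r' : rect C),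
    inc p r -> inc p r' -> inc p' r -> inc p' r' -> p = p' \/ r = r'.

Section IncidenceGraph.
Variable C : rect_config.

Definition inc_rel : rel (pt C + rect C) := fun u v =>
  match u, v with
  | inl p, inr r | inr r, inl p => inc p r
  | _, _ => false
  end.

Lemma inc_sym : symmetric inc_rel.
Proof. by move=> [p|r] [p'|r']. Qed.

Lemma inc_irr : irreflexive inc_rel.
Proof. by case. Qed.

Definition inc_graph : sgraph (pt C + rect C)%type := SGraph inc_sym inc_irr.

Lemma card_edges_inc_graph m :
  (forall p : pt C, m <= #|[set r | inc p r]|)%N ->
  (m * #|pt C| <= #|edges inc_graph|)%N.
Proof.
move=> deg; pose I := [set pr : pt C * rect C | inc pr.1 pr.2]%SET.
have cardI : (m * #|pt C| <= #|I|)%N.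
  rewrite -sum1_card (eq_bigl (fun pr => true && inc pr.1 pr.2)); last first.
    by move=> pr; rewrite inE.
  rewrite -(pair_big_dep xpredT (fun p r => inc p r) (fun _ _ => 1%N)) /=.
  rewrite mulnC -sum_nat_const; apply: leq_sum => p _.
  by rewrite sum1_card; have := deg p; rewrite cardsE.
pose f (pr : pt C * rect C) : {set pt C + rect C} := [set inl pr.1; inr pr.2]%SET.
have f_inj : injective f.
  move=> [p r] [p' r'] /setP eq_f; congr pair.
    by have := eq_f (inl p); rewrite !inE /= eqxx => /esym/orP[/eqP[]|/eqP].
  by have := eq_f (inr r); rewrite !inE /= eqxx => /esym/eqP[].
apply: leq_trans cardI _; rewrite -(card_imset _ f_inj).
apply/subset_leq_card/fintype.subsetP => _ /imsetP[[p r] pr ->].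
by apply/imsetP; exists (inl p, inr r); rewrite // !inE /= in pr *.
Qed.

Variable R : realType.

Definition corner (u : pt C + rect C) : seq nat :=
  match u with
  | inl p => [:: px p; px p; py p; py p]
  | inr r => [:: left r; right r; bottom r; top r]
  end.

Definition corner_map (u : pt C + rect C) : 'rV[R]_4 :=
  \row_(i < 4) (nth 0%N (corner u) i)%:R.

(** The point [p] lies strictly beyond one of the four sides of [r']; the coordinate in which
    [corner] stores that side separates the boxes. *)
Lemma separated_of_not_inc p r p' r' :
  inc p r -> inc p' r' -> ~~ inc p r' ->
  (box (corner_map (inl p)) (corner_map (inr r)) `&`
   box (corner_map (inl p')) (corner_map (inr r')))%classic = classical_sets.set0.
Proof.
move=> pr pr' npr'; apply: box_separated.
have sep (j : nat) (hj : (j < 4)%N) :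
    let c u := nth 0%N (corner u) j in
    (maxn (c (inl p)) (c (inr r)) < minn (c (inl p')) (c (inr r')))%N \/
    (maxn (c (inl p')) (c (inr r')) < minn (c (inl p)) (c (inr r)))%N ->
    exists i : 'I_4, let x u := corner_map u ord0 i in
      Num.max (x (inl p)) (x (inr r)) < Num.min (x (inl p')) (x (inr r')) \/
      Num.max (x (inl p')) (x (inr r')) < Num.min (x (inl p)) (x (inr r)).
  move=> /= H; exists (Ordinal hj); rewrite !mxE /=.
  by rewrite -!natr_max -!natr_min !ltr_nat.
move: pr pr' npr'; rewrite /inc => pr pr' npr'.
have [|] := ltnP (px p) (left r'); first by move=> ?; apply: (sep 0%N) => //=; lia.
have [|] := ltnP (right r') (px p); first by move=> ? _; apply: (sep 1%N) => //=; lia.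
have [|] := ltnP (py p) (bottom r'); first by move=> ? _ _; apply: (sep 2%N) => //=; lia.
by move=> *; apply: (sep 3%N) => //=; lia.
Qed.

Lemma separating_corner_map : K22_free C -> separating inc_graph corner_map.
Proof.
move=> K22.
have sep p r p' r' : inc p r -> inc p' r' -> p != p' -> r != r' ->
    (box (corner_map (inl p)) (corner_map (inr r)) `&`
     box (corner_map (inl p')) (corner_map (inr r')))%classic = classical_sets.set0.
  move=> pr pr' /eqP pp' /eqP rr'.
  have [pr'1|] := boolP (inc p r'); last exact: separated_of_not_inc.
  have [p'r|] := boolP (inc p' r).
    by case: (K22 _ _ _ _ pr pr'1 p'r pr').
  by rewrite classical_sets.setIC; exact: separated_of_not_inc.
have neq (u v u' v' : pt C + rect C) :
    ([set u; v] :&: [set u'; v'] = finset.set0)%SET ->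
    [&& u != u', u != v', v != u' & v != v'].
  move=> /setP disj; have := disj u; have := disj v.
  by rewrite !inE !eqxx orbT !andTb => /norP[-> ->] /norP[-> ->].
move=> [p|r] [p1|r1] [p'|r'] [p1'|r1'] //= pr pr' /neq/and4P[n1 n2 n3 n4];
  rewrite ?(boxC (corner_map (inr r))) ?(boxC (corner_map (inr r'))); exact: sep.
Qed.

End IncidenceGraph.

(** * Adding one digit to a configuration *)

Section Prism.
Variables (k : nat) (C : rect_config).
(** Shifting abscissas by multiples of [M] keeps the points of one copy off the rectangles of the
    others. *)
Variable M : nat.
Hypothesis px_lt : forall p : pt C, (px p < M)%N.
Hypothesis right_lt : forall r : rect C, (right r < M)%N.
Hypothesis py_inj : injective (@py C).

(* A new digit is added in front of the abscissa and at the end of the ordinate;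
   the rectangle [inr p] covers the copies of [p] as this digit varies. *)
Definition prism : rect_config := {|
  pt := ('I_k * pt C)%type;
  rect := ('I_k * rect C + pt C)%type;
  px := fun q => (q.1 * M + px q.2)%N;
  py := fun q => (py q.2 * k + q.1)%N;
  left := fun s => if s is inl (c, r) then (c * M + left r)%N else 0%N;
  right := fun s => if s is inl (c, r) then (c * M + right r)%N else (k * M)%N;
  bottom := fun s =>
    match s with inl (_, r) => bottom r * k | inr p => py p * k end%N;
  top := fun s =>
    match s with inl (_, r) => top r * k + k.-1 | inr p => py p * k + k.-1 end%N
|}.

(** Vertical sides end in the extreme digits [0] and [k.-1], so the new last digit of an ordinate
    does not affect the tests against them. *)
Lemma leq_digit a b c : (c < k)%N -> (a * k <= b * k + c)%N = (a <= b)%N.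
Proof. by move=> ck; apply/idP/idP; nia. Qed.

Lemma leq_digitr a b c : (c < k)%N -> (a * k + c <= b * k + k.-1)%N = (a <= b)%N.
Proof. by move=> ck; apply/idP/idP; nia. Qed.

Lemma inc_prism_old (c c' : 'I_k) p r :
  @inc prism (c, p) (inl (c', r)) = (c == c') && inc p r.
Proof.
rewrite /inc /= leq_digit // leq_digitr // [RHS]andbA; congr (_ && _).
rewrite -val_eqE /=; case: (ltngtP (c : nat) c') => [cc'|c'c|->] /=.
(* For [c < c'] the point falls left of the rectangle, for [c' < c] right of it. *)
- have := leq_mul cc' (leqnn M); rewrite mulSn leqNgt.
  by have := px_lt p; lia.
- have := leq_mul c'c (leqnn M); rewrite mulSn [X in _ && X]leqNgt.
  by have := right_lt r; lia.
- by rewrite !leq_add2l.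
Qed.

(** The strip spans all abscissas, and its ordinates single out [p'] because [py] is injective. *)
Lemma inc_prism_new (c : 'I_k) p p' :
  @inc prism (c, p) (inr p') = (p == p').
Proof.
rewrite /inc /= leq_digit // leq_digitr // -eqn_leq (inj_eq py_inj) eq_sym.
have -> : (c * M + px p <= k * M)%N; last by [].
by have := px_lt p; have := ltn_ord c; nia.
Qed.

(** Two old rectangles with a common point lie in one copy of [C]; an old and a new one determine
    the digit and the point; two new ones with a common point coincide. *)
Lemma K22_free_prism : K22_free C -> K22_free prism.
Proof.
move=> K22 [c p] [d q] [[c1 r1]|p1] [[c2 r2]|p2]; rewrite ?inc_prism_old ?inc_prism_new.
- move=> /andP[/eqP<- pr1] /andP[/eqP<- pr2] /andP[/eqP-> qr1] /andP[_ qr2].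
  by case: (K22 _ _ _ _ pr1 pr2 qr1 qr2) => ->; [left|right].
- by move=> /andP[/eqP<- _] /eqP-> /andP[/eqP-> _] /eqP->; left.
- by move=> /eqP-> /andP[/eqP<- _] /eqP-> /andP[/eqP-> _]; left.
- by move=> /eqP<- /eqP<-; right.
Qed.

Lemma py_prism_inj : injective (@py prism).
Proof.
move=> [c p] [d q] /= eq_pq; have ck := ltn_ord c; have dk := ltn_ord d.
have eq_p : py p = py q by nia.
by rewrite (py_inj eq_p); congr pair; apply: val_inj => /=; nia.
Qed.

Lemma degree_prism m :
  (forall p : pt C, m <= #|[set r | inc p r]|)%N ->
  forall q : pt prism, (m.+1 <= #|[set s | inc q s]|)%N.
Proof.
move=> deg [c p]; pose f r : rect prism := inl (c, r).
have f_inj : injective f by move=> r r' [].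
pose A : {set rect prism} := (inr p |: f @: [set r | inc p r])%SET.
have -> : (m.+1 <= #|[set s | @inc prism (c, p) s]|)%N; last by [].
have lt_mA : (m.+1 <= #|A|)%N.
  rewrite cardsU1 (card_imset _ f_inj).
  have -> /= : inr p \notin (f @: [set r | inc p r])%SET.
    by apply/negP => /imsetP[].
  by rewrite add1n ltnS.
apply: leq_trans lt_mA _; apply/subset_leq_card/fintype.subsetP => s.
rewrite !inE => /orP[/eqP->|/imsetP[r]]; first by rewrite inc_prism_new.
by rewrite inE => pr ->; rewrite inc_prism_old eqxx.
Qed.

End Prism.

(** Induction on the number [m] of digits: each [prism] step multiplies the points by [k] and gives
    every point one more rectangle. *)
Lemma grid_config (t k m : nat) : (0 < k)%N ->
  exists C : rect_config, [/\ K22_free C, injective (@py C),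
    #|pt C| = (t * k ^ m)%N, (#|rect C| * k = m * #|pt C|)%N &
    forall p : pt C, (m <= #|[set r | inc p r]|)%N].
Proof.
move=> k_gt0; elim: m => [|m [C [K22 py_inj card_pt card_rect deg]]].
  (* Base case: [t] points on the diagonal and no rectangles. *)
  pose z := fun _ : void => 0%N.
  exists (RectConfig (@nat_of_ord t) (@nat_of_ord t) z z z z).
  by split=> //=; [exact: ord_inj|rewrite card_ord muln1|rewrite card_void].
pose M := (\sum_(p : pt C) px p + \sum_(r : rect C) right r).+1.
have px_lt (p : pt C) : (px p < M)%N by rewrite /M (bigD1 p) //=; lia.
have right_lt (r : rect C) : (right r < M)%N by rewrite /M (bigD1 r (P := xpredT)) //=; lia.
exists (prism k C M); split.
- exact: K22_free_prism.
- exact: py_prism_inj.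
- by rewrite /= card_prod card_ord card_pt expnS mulnCA.
- by rewrite /= card_sum !card_prod card_ord; nia.
- exact: degree_prism.
Qed.

(** With [m = k] there are as many rectangles as points, [t * k ^ k] of each. *)
Lemma grid_graph (R : realType) (t k n : nat) :
  (0 < k)%N -> (2 * (t * k ^ k) <= n)%N ->
  exists G : sgraph 'I_n, (k * (t * k ^ k) <= #|edges G|)%N /\
    exists phi : 'I_n -> 'rV[R]_4, separating G phi.
Proof.
move=> k_gt0 le_n; have [C [K22 _ card_pt card_rect deg]] := grid_config t k k_gt0.
have card_V : (#|{: pt C + rect C}| <= n)%N by rewrite card_sum; nia.
pose e (u : (pt C + rect C)%type) := widen_ord card_V (enum_rank u).
have e_inj : injective e.
  by move=> u v /(congr1 val) /= /val_inj/enum_rank_inj.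
exists (extend (inc_graph C) e_inj); split.
  rewrite -card_pt; apply: leq_trans (card_edges_extend _ e_inj).
  exact: card_edges_inc_graph.
exact/separating_extend/separating_corner_map.
Qed.

(** * Asymptotics and choice of parameters *)

Lemma ln_div_lnln_le (R : realType) (n k : nat) :
  (0 < k)%N -> expR 1 <= ln (n%:R : R) -> (n < 2 * k.+1 ^ k.+1)%N ->
  ln (n%:R : R) / ln (ln (n%:R : R)) <= 4 * k%:R.
Proof.
set L := ln _ => k_gt0 eL n_lt.
have e_gt0 := expR_gt0 (1 : R); have e_ge2 := expR_ge1Dx (1 : R).
have L_gt0 : 0 < L by exact: lt_le_trans eL.
have lnL_ge1 : 1 <= ln L by rewrite -(expRK (1 : R)) ler_ln.
(* The convention [ln 0 = 0] excludes [n = 0]. *)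
have n_gt0 : (0 < n)%N.
  by case: n @L n_lt eL e_gt0 L_gt0 lnL_ge1 => // L; rewrite /L ln0 // ltxx.
have lnL_gt0 : 0 < ln L by lra.
have lnk_ge0 : 0 <= ln (k.+1%:R : R) by rewrite ln_ge0 // ler1n.
have L_lt : L < ln 2 + k.+1%:R * ln (k.+1%:R : R).
  rewrite mulr_natl -lnXn // -lnM ?posrE ?exprn_gt0 //.
  by rewrite ltr_ln ?posrE ?mulr_gt0 ?exprn_gt0 ?ltr0n // -natrX -natrM ltr_nat.
have ln2_le1 : ln (2 : R) <= 1 by have := @le_ln1Dx R 1 ltac:(lra); rewrite -natr1; lra.
have k1_le : (k.+1%:R : R) <= 2 * k%:R by rewrite -natrM ler_nat; lia.
suff : L / ln L <= 2 * k.+1%:R by lra.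
(* Otherwise [k.+1 <= L], so [k.+1 * ln k.+1 <= k.+1 * ln L < L / 2]; then [L_lt] gives
   [L < 1 + L / 2], against [L >= 2]. *)
rewrite leNgt; apply/negP => k_lt.
have k_ltL : 2 * k.+1%:R * ln L < L by rewrite -ltr_pdivlMr.
have k_leL : (k.+1%:R : R) <= L by have := ler0n R k.+1; nra.
have lnk_le : ln (k.+1%:R : R) <= ln L by rewrite ler_ln ?posrE ?ltr0n.
have : k.+1%:R * ln (k.+1%:R : R) <= k.+1%:R * ln L by rewrite ler_wpM2l.
lra.
Qed.

Lemma max_self_power (n : nat) : (2 <= n)%N ->
  exists2 k, (0 < k)%N & (2 * k ^ k <= n < 2 * k.+1 ^ k.+1)%N.
Proof.
move=> n_ge2; pose P k := (0 < k)%N && (2 * k ^ k <= n)%N.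
have exP : exists k, P k by exists 1%N.
have leP k : P k -> (k <= n)%N.
  by move=> /andP[k_gt0]; have := leq_pexp2l k_gt0 k_gt0; rewrite expn1; lia.
have [k /andP[k_gt0 k_le] maxk] := ex_maxnP exP leP.
exists k; rewrite ?k_le //= ltnNge; apply/negP => k1_le.
by have := maxk k.+1; rewrite /P /= k1_le ltnn => /(_ isT).
Qed.

Theorem theorem9 (R : realType) :
  exists (c : R) (n0 : nat), 0 < c /\
    forall n : nat, (n0 <= n)%N ->
      exists G : sgraph 'I_n,
        c * n%:R * (ln (n%:R : R) / ln (ln (n%:R : R))) <= #|edges G|%:R /\
        exists2 d : nat, is_separation_dim R G d & (d <= 6)%N.
Proof.
(* Beyond [e ^ e] one has [ln n >= e], hence [ln (ln n) >= 1]. *)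
pose n0 := (Num.bound (expR (expR 1) : R)).+2.
(* One factor 4 comes from [n_le], the other from [ln_div_lnln_le]. *)
exists 16^-1, n0; split=> [|n n0_le]; first by rewrite invr_gt0.
have eL : expR 1 <= ln (n%:R : R).
  rewrite -[leLHS]expRK ler_ln ?posrE ?expR_gt0 ?ltr0n //; last by lia.
  apply: ltW; apply: lt_le_trans (archi_boundP (expR_ge0 _)) _.
  by rewrite ler_nat; lia.
have n_ge2 : (2 <= n)%N by lia.
have [k k_gt0 /andP[k_le n_lt]] := max_self_power n_ge2.
pose t := (n %/ (2 * k ^ k))%N.
have kk_gt0 : (0 < 2 * k ^ k)%N by rewrite muln_gt0 expn_gt0 k_gt0.
have t_gt0 : (0 < t)%N by rewrite divn_gt0.
have t_le : (2 * (t * k ^ k) <= n)%N by rewrite mulnCA leq_divM.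
(* Since [t >= 1], rounding down in [t] loses at most a factor 2. *)
have n_le : (n <= 4 * (t * k ^ k))%N.
  by have := ltn_ceil n kk_gt0; rewrite -/t; nia.
have [G [card_G [phi sep]]] := grid_graph R k_gt0 t_le.
exists G; split; last first.
  by have [d Gd d_le] := separation_dim_exists sep; exists d => //; lia.
have edges_ge : (n%:R : R) * k%:R <= 4 * #|edges G|%:R.
  by rewrite -!natrM ler_nat; nia.
have L_le := ler_wpM2l (ler0n R n) (ln_div_lnln_le k_gt0 eL n_lt).
rewrite -mulrA ler_pdivrMl //; lra.
Qed.
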